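(* Let $m\in\mathbf N_0=\{0,1,2,\ldots\}$ and $\theta,\theta',\theta_2,\theta_2'\in[0,\pi]$. Put $$A:=\cos\theta\cos\theta'+\sin\theta\sin\theta'\cos\theta_2\cos\theta_2',\qquad B:=\sin\theta\sin\theta'\sin\theta_2\sin\theta_2',$$ and assume $B>0$, $\frac{1-A}{B}>1$ and $\frac{1+A}{B}>1$. Let $\alpha,k>0$ be defined by $$\alpha^2=\frac{2B}{1-A+B},\qquad k^2=\frac{4B}{(1+A+B)(1-A+B)}.$$ Then the $m$-th azimuthal Fourier coefficient $\mathsf G_m^{1/2}$ of the fundamental solution $\mathfrak g^3$ of Laplace's equation on the unit hypersphere $\mathbf S^3$ in standard hyperspherical coordinates is $$\mathsf G_m^{1/2}(\theta,\theta',\theta_2,\theta_2')=\frac{2B\,\epsilon_m}{\pi\sqrt{(1-A+B)(1+A+B)}}\sum_{p=0}^{m+1}\sum_{j=0}^{p}a_p\,\frac{(B-1+A)^j}{B^p(1-A)^{j-p}}\binom pj V_j(\alpha,k),$$ where $$a_p=\begin{cases}\dfrac{A\,(m)_m\left(\frac{-m}{2}\right)_{\frac{m-p}{2}}\left(\frac{-m+1}{2}\right)_{\frac{m-p}{2}}}{2^mB\left(\frac12\right)_m(1-m)_{\frac{m-p}{2}}\left(\frac{m-p}{2}\right)!}&\text{if }p=m-2\lfloor\frac m2\rfloor,\ldots,m-2,m,\\[3mm]\dfrac{(m)_m\left(\frac{-m}{2}\right)_{\frac{m-p+1}{2}}\left(\frac{-m+1}{2}\right)_{\frac{m-p+1}{2}}}{2^m\left(\frac12\right)_m(1-m)_{\frac{m-p+1}{2}}\left(\frac{m-p+1}{2}\right)!}&\text{if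 }p=m-2\lfloor\frac m2\rfloor+1,\ldots,m-1,m+1,\end{cases}$$ (in both cases $p$ runs in steps of $2$, and $a_p=0$ for any $p\in\{0,\ldots,m+1\}$ in neither list), and where $$V_0(\alpha,k)=K(k),\qquad V_1(\alpha,k)=\Pi(\alpha^2,k),$$ $$V_2(\alpha,k)=\frac{1}{2(\alpha^2-1)(k^2-\alpha^2)}\Big[(k^2-\alpha^2)K(k)+\alpha^2E(k)+(2\alpha^2k^2+2\alpha^2-\alpha^4-3k^2)\Pi(\alpha^2,k)\Big],$$ and $V_j(\alpha,k)$ for $j\ge3$ is given by the recurrence, for $j\ge 0$, $$V_{j+3}(\alpha,k)=\frac{1}{2(j+2)(1-\alpha^2)(k^2-\alpha^2)}\Big[(2j+1)k^2V_j(\alpha,k)+2(j+1)(\alpha^2k^2+\alpha^2-3k^2)V_{j+1}(\alpha,k)+(2j+3)(\alpha^4-2\alpha^2k^2-2\alpha^2+3k^2)V_{j+2}(\alpha,k)\Big].$$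
   Context: Points of $\mathbf S^3\subset\mathbf R^4$ are parametrized by $x_0=\cos\theta$, $x_1=\sin\theta\cos\theta_2$, $x_2=\sin\theta\sin\theta_2\cos\phi$, $x_3=\sin\theta\sin\theta_2\sin\phi$, with $\theta,\theta_2\in[0,\pi]$, $\phi\in[-\pi,\pi)$. The fundamental solution (up to a constant factor) is $$\mathfrak g^3(\widehat{\mathbf x},\widehat{\mathbf x}'):=\cot d(\widehat{\mathbf x},\widehat{\mathbf x}'),\qquad \cos d(\widehat{\mathbf x},\widehat{\mathbf x}')=A+B\cos(\phi-\phi'),\quad d\in[0,\pi],$$ where $3$ is an index (the dimension), not a power. Its azimuthal Fourier coefficients, determined by $\mathfrak g^3(\widehat{\mathbf x},\widehat{\mathbf x}')=\sum_{m=0}^\infty \mathsf G_m^{1/2}(\theta,\theta',\theta_2,\theta_2')\cos(m(\phi-\phi'))$, are $$\mathsf G_m^{1/2}(\theta,\theta',\theta_2,\theta_2')=\frac{\epsilon_m}{\pi}\int_0^\pi\frac{(A+B\cos\psi)\cos(m\psi)}{\sqrt{1-(A+B\cos\psi)^2}}\,d\psi,$$ with Neumann factor $\epsilon_0=1$, $\epsilon_m=2$ for $m\ge1$. Pochhammer symbol: $(a)_0=1$, $(a)_n=a(a+1)\cdots(a+n-1)$. Complete elliptic integrals: $$K(k)=\int_0^{\pi/2}\frac{dt}{\sqrt{1-k^2\sin^2t}},\quad E(k)=\int_0^{\pi/2}\sqrt{1-k^2\sin^2t}\,dt,\quad \Pi(\alpha^2,k)=\int_0^{\pi/2}\frac{dt}{\sqrt{1-k^2\sin^2t}\,(1-\alpha^2\sin^2t)}.$$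 *)

(* Defs.v *)
From Stdlib Require Import Reals ZArith Arith Lra Lia.
From Coquelicot Require Import Coquelicot.

Open Scope R_scope.

(** Standard hyperspherical coordinates on the unit sphere [S^3] of [R^4]. *)
Definition hpoint (theta theta2 phi : R) : R * R * R * R :=
  (cos theta,
   sin theta * cos theta2,
   sin theta * sin theta2 * cos phi,
   sin theta * sin theta2 * sin phi).

Definition dot4 (x y : R * R * R * R) : R :=
  let '(x0, x1, x2, x3) := x in
  let '(y0, y1, y2, y3) := y in
  x0 * y0 + x1 * y1 + x2 * y2 + x3 * y3.

Definition geodist (x y : R * R * R * R) : R := acos (dot4 x y).

Definition cot (t : R) : R := cos t / sin t.

Definition g3 (x y : R * R * R * R) : R := cot (geodist x y).

Definition neumann (m : nat) : R := if Nat.eqb m 0 then 1 else 2.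

(** Coefficients of the azimuthal expansion
      [g3 x x' = sum_m G_half m * cos (m * (phi - phi'))].
    [g3] depends on the azimuths only through [cos (phi - phi')]
    ([dot4_hpoint]), so they are the cosine coefficients of
    [psi = phi - phi'], computed here at [phi' = 0]. *)
Definition G_half (m : nat) (theta theta' theta2 theta2' : R) : R :=
  neumann m / PI *
  RInt (fun psi => g3 (hpoint theta theta2 psi) (hpoint theta' theta2' 0)
                   * cos (INR m * psi)) 0 PI.

Lemma dot4_hpoint (theta theta' theta2 theta2' phi phi' : R) :
  dot4 (hpoint theta theta2 phi) (hpoint theta' theta2' phi') =
  (cos theta * cos theta' + sin theta * sin theta' * cos theta2 * cos theta2')
  + sin theta * sin theta' * sin theta2 * sin theta2' * cos (phi - phi').
Proof. unfold dot4, hpoint. rewrite cos_minus. ring. Qed.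

Lemma dot4_hpoint_bound (theta theta' theta2 theta2' phi phi' : R) :
  -1 <= dot4 (hpoint theta theta2 phi) (hpoint theta' theta2' phi') <= 1.
Proof.
assert (unit4 : forall t u v,
  dot4 (hpoint t u v) (hpoint t u v) = 1).
{ intros t u v. unfold dot4, hpoint.
  assert (Ht := sin2_cos2 t). assert (Hu := sin2_cos2 u).
  assert (Hv := sin2_cos2 v). unfold Rsqr in *.
  replace (_ + _ + _ + _) with
    (cos t * cos t + sin t * sin t * (cos u * cos u
       + sin u * sin u * (sin v * sin v + cos v * cos v))) by ring.
  rewrite Hv. nra. }
assert (H1 := unit4 theta theta2 phi).
assert (H2 := unit4 theta' theta2' phi').
destruct (hpoint theta theta2 phi) as [[[x0 x1] x2] x3].
destruct (hpoint theta' theta2' phi') as [[[y0 y1] y2] y3].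
unfold dot4 in *; cbv beta iota zeta in *.
assert (Hp : forall a b : R, 0 <= (a + b) * (a + b)) by (intros; apply Rle_0_sqr).
assert (Hm : forall a b : R, 0 <= (a - b) * (a - b)) by (intros; apply Rle_0_sqr).
assert (P0 := Hp x0 y0). assert (P1 := Hp x1 y1).
assert (P2 := Hp x2 y2). assert (P3 := Hp x3 y3).
assert (M0 := Hm x0 y0). assert (M1 := Hm x1 y1).
assert (M2 := Hm x2 y2). assert (M3 := Hm x3 y3).
split; lra.
Qed.

Lemma G_half_integral (m : nat) (theta theta' theta2 theta2' A B : R) :
  A = cos theta * cos theta'
      + sin theta * sin theta' * cos theta2 * cos theta2' ->
  B = sin theta * sin theta' * sin theta2 * sin theta2' ->
  G_half m theta theta' theta2 theta2' =
  neumann m / PI *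
  RInt (fun psi => (A + B * cos psi) * cos (INR m * psi)
                   / sqrt (1 - (A + B * cos psi) ^ 2)) 0 PI.
Proof.
intros -> ->. unfold G_half. f_equal. apply RInt_ext. intros psi _.
unfold g3, cot, geodist.
rewrite cos_acos, sin_acos by apply dot4_hpoint_bound.
rewrite dot4_hpoint, Rminus_0_r, Rsqr_pow2.
assert (comm : forall c s t : R, c / s * t = c * t / s)
  by (intros; unfold Rdiv; ring).
apply comm.
Qed.

Fixpoint pochhammer (a : R) (n : nat) : R :=
  match n with
  | O => 1
  | S n' => pochhammer a n' * (a + INR n')
  end.

Definition ellK (k : R) : R :=
  RInt (fun t => 1 / sqrt (1 - k ^ 2 * sin t ^ 2)) 0 (PI / 2).

Definition ellE (k : R) : R :=
  RInt (fun t => sqrt (1 - k ^ 2 * sin t ^ 2)) 0 (PI / 2).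

(** The first argument is the characteristic [alpha ^ 2] itself. *)
Definition ellPi (n k : R) : R :=
  RInt (fun t => 1 / (sqrt (1 - k ^ 2 * sin t ^ 2) * (1 - n * sin t ^ 2)))
    0 (PI / 2).

(** In the last branch [n1 = j + 1] and [n2 = j + 2]. *)
Fixpoint V (alpha k : R) (n : nat) {struct n} : R :=
  match n with
  | O => ellK k
  | S O => ellPi (alpha ^ 2) k
  | S (S O) =>
      1 / (2 * (alpha ^ 2 - 1) * (k ^ 2 - alpha ^ 2)) *
      ((k ^ 2 - alpha ^ 2) * ellK k
       + alpha ^ 2 * ellE k
       + (2 * alpha ^ 2 * k ^ 2 + 2 * alpha ^ 2 - alpha ^ 4 - 3 * k ^ 2)
         * ellPi (alpha ^ 2) k)
  | S (S (S j as n1) as n2) =>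
      1 / (2 * (INR j + 2) * (1 - alpha ^ 2) * (k ^ 2 - alpha ^ 2)) *
      ((2 * INR j + 1) * k ^ 2 * V alpha k j
       + 2 * (INR j + 1) * (alpha ^ 2 * k ^ 2 + alpha ^ 2 - 3 * k ^ 2)
         * V alpha k n1
       + (2 * INR j + 3)
         * (alpha ^ 4 - 2 * alpha ^ 2 * k ^ 2 - 2 * alpha ^ 2 + 3 * k ^ 2)
         * V alpha k n2)
  end.

(** Membership of [p] in [lo, lo + 2, ..., hi], where [hi - lo] is even. *)
Definition in_steps2 (lo hi p : nat) : bool :=
  (Nat.leb lo p && Nat.leb p hi && Nat.even (hi - p))%bool.

Definition acoef (A B : R) (m p : nat) : R :=
  if in_steps2 (m - 2 * (m / 2)) m p then
    let n := ((m - p) / 2)%nat in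
    A * pochhammer (INR m) m * pochhammer (- INR m / 2) n
      * pochhammer ((- INR m + 1) / 2) n
    / (2 ^ m * B * pochhammer (1 / 2) m * pochhammer (1 - INR m) n
       * INR (fact n))
  else if in_steps2 (m - 2 * (m / 2) + 1) (m + 1) p then
    let n := ((m - p + 1) / 2)%nat in
    pochhammer (INR m) m * pochhammer (- INR m / 2) n
      * pochhammer ((- INR m + 1) / 2) n
    / (2 ^ m * pochhammer (1 / 2) m * pochhammer (1 - INR m) n
       * INR (fact n))
  else 0.

(* Main.v *)
Require Import Defs.
From Stdlib Require Import Reals ZArith Arith Lra Lia.
From Coquelicot Require Import Coquelicot.

Open Scope R_scope.

(** The polynomial [B * sum_p a_p x^p] is [(A + B x) T_m x], with [T_m] the
    Chebyshev polynomial.  The substitution [tan (psi / 2) = c tan t], with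
    [c = sqrt (1 - alpha^2)], has [psi' = 2 c / w] for [w = 1 - alpha^2 sin^2 t],
    turns [cos psi] into [(1 - A) / B + (B - 1 + A) / (B w)] and the square root
    into a multiple of [sqrt (1 - k^2 sin^2 t) / w].  Expanding [cos^p psi] by the
    binomial theorem leaves the integrals of [w^-j / sqrt (1 - k^2 sin^2 t)];
    integrating the derivative of [sin t cos t sqrt (1 - k^2 sin^2 t) / w^(i+1)]
    over [0, PI / 2] shows that they satisfy the recurrence of [V]. *)

(** * Chebyshev coefficients *)

Ltac push_INR :=
  repeat (rewrite S_INR || rewrite plus_INR || rewrite mult_INR); simpl (INR 0).

Lemma pochhammer_S (a : R) (n : nat) :
  pochhammer a (S n) = pochhammer a n * (a + INR n).
Proof. reflexivity. Qed.

Lemma pochhammer_INR_S (a n : nat) :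
  pochhammer (INR (S a)) n = INR (fact (a + n)) / INR (fact a).
Proof.
induction n as [|n IH].
- rewrite Nat.add_0_r. simpl pochhammer. field. apply INR_fact_neq_0.
- rewrite pochhammer_S, IH, <- plus_INR, Nat.add_succ_r, fact_simpl, mult_INR.
  simpl Nat.add. field. apply INR_fact_neq_0.
Qed.

Lemma pochhammer_half (n : nat) :
  pochhammer (1 / 2) n = INR (fact (2 * n)) / (4 ^ n * INR (fact n)).
Proof.
induction n as [|n IH]; [simpl; field|].
replace (2 * S n)%nat with (S (S (2 * n))) by lia.
rewrite !fact_simpl, pochhammer_S, IH, !mult_INR, !S_INR, mult_INR.
simpl (INR 2). simpl pow.
assert (H := pos_INR n). field.
repeat split; try apply INR_fact_neq_0; try apply pow_nonzero; lra.
Qed.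

(** The coefficient of [x^(m - 2 n)] in the Chebyshev polynomial [T_m], in the Pochhammer form
    common to both branches of [acoef]. *)
Definition cheb_coef (m n : nat) : R :=
  pochhammer (INR m) m * pochhammer (- INR m / 2) n
    * pochhammer ((- INR m + 1) / 2) n
  / (2 ^ m * pochhammer (1 / 2) m * pochhammer (1 - INR m) n * INR (fact n)).

Lemma cheb_coef_S_0 (m : nat) : cheb_coef (S m) 0 = 2 ^ m.
Proof.
unfold cheb_coef. rewrite pochhammer_INR_S, pochhammer_half.
replace (2 * S m)%nat with (S (m + S m)) by lia.
rewrite (fact_simpl (m + S m)), (fact_simpl m), !mult_INR.
replace 4 with (2 * 2) by ring. rewrite Rpow_mult_distr.
simpl pochhammer. simpl (fact 0). simpl (INR 1). simpl pow.
rewrite (S_INR (m + S m)), plus_INR, !S_INR. assert (H := pos_INR m). field.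
repeat split; try apply INR_fact_neq_0; try apply pow_nonzero; lra.
Qed.

Lemma cheb_coef_S (m n : nat) :
  cheb_coef m (S n) =
  cheb_coef m n * ((- INR m / 2 + INR n) * ((- INR m + 1) / 2 + INR n)
                   / ((1 - INR m + INR n) * INR (S n))).
Proof.
unfold cheb_coef, Rdiv. rewrite fact_simpl, mult_INR, !pochhammer_S, !Rinv_mult. ring.
Qed.

(** The classical form [(-1)^n 2^r (m / 2) (m - n - 1)! / (n! r!)] with [m = 2 n + r]. Taking the
    power [r] as parameter avoids subtraction; [(n + r)! / (n + r)] stands for [(m - n - 1)!], and
    [0 < n + r] excludes 0 / 0 at degree 0. *)
Lemma cheb_coef_closed (n r : nat) : (0 < n + r)%nat ->
  cheb_coef (2 * n + r) n =
  (-1) ^ n * 2 ^ r * INR (2 * n + r) * INR (fact (n + r))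
  / (2 * INR (n + r) * INR (fact n) * INR (fact r)).
Proof.
revert r. induction n as [|n IH]; intros r Hr.
- destruct r as [|r]; [lia|].
  change (2 * 0 + S r)%nat with (S r). change (0 + S r)%nat with (S r).
  rewrite cheb_coef_S_0. simpl (fact 0). simpl pow. simpl (INR 1).
  field. split; [apply INR_fact_neq_0 | apply not_0_INR; lia].
- rewrite cheb_coef_S.
  (* At fixed degree, raising [n] by one lowers the power by two, so the induction hypothesis is
     taken at [r + 2]. *)
  replace (2 * S n + r)%nat with (2 * n + S (S r))%nat by lia.
  rewrite IH by lia.
  replace (n + S (S r))%nat with (S (S n + r)) by lia.
  rewrite (fact_simpl (S n + r)), (fact_simpl (S r)), (fact_simpl r), (fact_simpl n).
  push_INR. simpl pow.
  assert (H := pos_INR n). assert (H' := pos_INR r). field.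
  repeat split; try apply INR_fact_neq_0; lra.
Qed.

(** The coefficient of [x^(r + 1)] in [T_(M+2) = 2 x T_(M+1) - T_M], with [M = 2 n + r + 1]. *)
Lemma cheb_coef_rec (n r : nat) :
  cheb_coef (2 * S n + S r) (S n) =
  2 * cheb_coef (2 * S n + r) (S n) - cheb_coef (2 * n + S r) n.
Proof.
rewrite !cheb_coef_closed by lia.
replace (S n + S r)%nat with (S (S (n + r))) by lia.
replace (S n + r)%nat with (S (n + r)) by lia.
replace (n + S r)%nat with (S (n + r)) by lia.
rewrite !fact_simpl. push_INR. simpl pow.
assert (H := pos_INR n). assert (H' := pos_INR r). field.
repeat split; try apply INR_fact_neq_0; lra.
Qed.

(** The constant term of the same recurrence, to which [2 x T_(M+1)] contributes nothing. *)
Lemma cheb_coef_rec_0 (n : nat) :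
  cheb_coef (2 * S n) (S n) = - cheb_coef (2 * n) n.
Proof.
(* For [n = 0] the right side has degree 0, outside the range of [cheb_coef_closed]. *)
destruct n as [|n]; [unfold cheb_coef; simpl; field|].
replace (2 * S (S n))%nat with (2 * S (S n) + 0)%nat by lia.
replace (2 * S n)%nat with (2 * S n + 0)%nat by lia.
rewrite !cheb_coef_closed by lia. rewrite !Nat.add_0_r.
rewrite !fact_simpl. push_INR. simpl pow.
assert (H := pos_INR n). field.
repeat split; try apply INR_fact_neq_0; try apply pow_nonzero; simpl; lra.
Qed.

(** Coefficients of [T_m] indexed by the power. The test [p <= m] guards against truncated
    subtraction, which makes [m - p] even for every larger [p]. *)
Definition cheb_pow (m p : nat) : R :=
  if (Nat.leb p m && Nat.even (m - p))%bool then cheb_coef m ((m - p) / 2) else 0.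

Lemma cheb_pow_even (n p : nat) : cheb_pow (2 * n + p) p = cheb_coef (2 * n + p) n.
Proof.
unfold cheb_pow. replace (2 * n + p - p)%nat with (n * 2)%nat by lia.
rewrite Nat.div_mul, Nat.even_mul by lia.
rewrite Bool.orb_true_r, (proj2 (Nat.leb_le _ _)) by lia. reflexivity.
Qed.

Lemma cheb_pow_0 (m p : nat) : (forall n, m <> (2 * n + p)%nat) -> cheb_pow m p = 0.
Proof.
intros H. unfold cheb_pow.
destruct (Nat.leb_spec p m) as [Hp|Hp]; [|reflexivity].
destruct (Nat.even (m - p)) eqn:He; [|reflexivity].
apply Nat.even_spec in He. destruct He as [n Hn]. exfalso. apply (H n). lia.
Qed.

Lemma cheb_pow_rec (m p : nat) :
  cheb_pow (S (S m)) (S p) = 2 * cheb_pow (S m) p - cheb_pow m (S p).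
Proof.
destruct (Nat.lt_ge_cases (S m) p) as [Hp|Hp].
{ rewrite !cheb_pow_0 by (intros; lia). ring. }
destruct (Nat.Even_or_Odd (S m - p)) as [[n Hn]|[n Hn]].
2: { rewrite !cheb_pow_0 by (intros; lia). ring. }
replace (S (S m)) with (2 * n + S p)%nat by lia.
replace (S m) with (2 * n + p)%nat by lia.
rewrite !cheb_pow_even.
destruct n as [|n].
(* The leading term: [T_m] does not reach this power, and the leading coefficient doubles. *)
- rewrite (cheb_pow_0 m (S p)) by (intros; lia).
  assert (Hm : p = S m) by lia. rewrite Hm.
  change (2 * 0 + S (S m))%nat with (S (S m)). change (2 * 0 + S m)%nat with (S m).
  rewrite !cheb_coef_S_0. simpl pow. ring.
- replace m with (2 * n + S p)%nat by lia.
  rewrite cheb_pow_even. apply cheb_coef_rec.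
Qed.

Lemma cheb_pow_rec_0 (m : nat) : cheb_pow (S (S m)) 0 = - cheb_pow m 0.
Proof.
destruct (Nat.Even_or_Odd m) as [[n Hn]|[n Hn]].
2: { rewrite !cheb_pow_0 by (intros; lia). ring. }
replace (S (S m)) with (2 * S n + 0)%nat by lia.
replace m with (2 * n + 0)%nat by lia.
rewrite !cheb_pow_even, !Nat.add_0_r. apply cheb_coef_rec_0.
Qed.

Lemma cheb_poly_rec (m : nat) (x : R) :
  sum_f_R0 (fun p => cheb_pow (S (S m)) p * x ^ p) (S (S m)) =
  2 * x * sum_f_R0 (fun p => cheb_pow (S m) p * x ^ p) (S m)
  - sum_f_R0 (fun p => cheb_pow m p * x ^ p) m.
Proof.
(* Padding with zero terms gives [T_m] the range of [T_(m+2)]; the constant term is then split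
   off. *)
replace (sum_f_R0 (fun p => cheb_pow m p * x ^ p) m)
  with (sum_f_R0 (fun p => cheb_pow m p * x ^ p) (S (S m)))
  by (simpl sum_f_R0; rewrite !(cheb_pow_0 m) by (intros; lia); ring).
rewrite !(decomp_sum _ (S (S m))) by lia. simpl Nat.pred.
rewrite cheb_pow_rec_0, scal_sum.
rewrite (sum_eq _ (fun p => cheb_pow (S m) p * x ^ p * (2 * x)
                            - cheb_pow m (S p) * x ^ S p) (S m))
  by (intros p _; rewrite cheb_pow_rec; simpl pow; ring).
rewrite minus_sum. simpl (x ^ 0). ring.
Qed.

(** Both sides satisfy [X_(m+2) = 2 cos psi X_(m+1) - X_m]; the induction carries two consecutive
    degrees. *)
Lemma cos_mult_cheb (m : nat) (psi : R) :
  cos (INR m * psi) = sum_f_R0 (fun p => cheb_pow m p * cos psi ^ p) m.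
Proof.
assert (H : cos (INR m * psi) = sum_f_R0 (fun p => cheb_pow m p * cos psi ^ p) m
         /\ cos (INR (S m) * psi)
            = sum_f_R0 (fun p => cheb_pow (S m) p * cos psi ^ p) (S m)).
{ induction m as [|m [IH0 IH1]].
  - split.
    + simpl. rewrite Rmult_0_l, cos_0. unfold cheb_pow, cheb_coef. simpl. field.
    + simpl. rewrite Rmult_1_l. unfold cheb_pow, cheb_coef. simpl. field.
  - split; [exact IH1|]. rewrite cheb_poly_rec, <- IH0, <- IH1.
    replace (INR m * psi) with (INR (S m) * psi - psi) by (rewrite S_INR; ring).
    replace (INR (S (S m)) * psi) with (INR (S m) * psi + psi)
      by (rewrite (S_INR (S m)); ring).
    rewrite cos_plus, cos_minus. ring. }
apply H.
Qed.

(** * The coefficients [a_p] *)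

Lemma in_steps2_spec (lo hi p : nat) :
  in_steps2 lo hi p = true <-> (lo <= p <= hi)%nat /\ Nat.Even (hi - p).
Proof.
unfold in_steps2.
rewrite !Bool.andb_true_iff, !Nat.leb_le, Nat.even_spec. tauto.
Qed.

(** These are the coefficients of [(A / B + x) T_m]. The two lists of [p] have opposite parities, so
    at most one summand is nonzero. *)
Lemma acoef_cheb (A B : R) (m p : nat) : B <> 0 ->
  acoef A B m p =
  A / B * cheb_pow m p + match p with O => 0 | S q => cheb_pow m q end.
Proof.
intros HB. unfold acoef.
assert (Hm := Nat.div_mod_eq m 2). assert (Hm' := Nat.mod_upper_bound m 2).
destruct (in_steps2 (m - 2 * (m / 2)) m p) eqn:H1.
- apply in_steps2_spec in H1. destruct H1 as [H1 [n Hn]].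
  replace (match p with O => 0 | S q => cheb_pow m q end) with 0
    by (destruct p as [|p]; [|rewrite cheb_pow_0 by (intros; lia)]; reflexivity).
  rewrite Hn, (Nat.mul_comm 2 n), Nat.div_mul by lia.
  replace m with (2 * n + p)%nat by lia. rewrite cheb_pow_even.
  unfold cheb_coef, Rdiv. rewrite !Rinv_mult. ring.
- rewrite (cheb_pow_0 m p), Rmult_0_r, Rplus_0_l.
  2: { intros n Hn. apply Bool.not_true_iff_false in H1. apply H1.
       apply in_steps2_spec. split; [lia|]. exists n. lia. }
  destruct (in_steps2 (m - 2 * (m / 2) + 1) (m + 1) p) eqn:H2.
  + apply in_steps2_spec in H2. destruct H2 as [H2 [n Hn]].
    destruct p as [|p]; [lia|].
    replace ((m - S p + 1) / 2)%nat with n.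
    * replace m with (2 * n + p)%nat by lia. rewrite cheb_pow_even. reflexivity.
    * destruct n as [|n].
      (* Here [S p = m + 1]: truncation makes the numerator 1 instead of 0, and [1 / 2 = 0] is still
         the right index. *)
      -- replace (m - S p + 1)%nat with 1%nat by lia. reflexivity.
      -- replace (m - S p + 1)%nat with (S n * 2)%nat by lia.
         rewrite Nat.div_mul; lia.
  + destruct p as [|p]; [reflexivity|]. symmetry. apply cheb_pow_0.
    intros n Hn. apply Bool.not_true_iff_false in H2. apply H2.
    apply in_steps2_spec. split; [lia|]. exists n. lia.
Qed.

Lemma acoef_sum (A B psi : R) (m : nat) : B <> 0 ->
  B * sum_f_R0 (fun p => acoef A B m p * cos psi ^ p) (m + 1) =
  (A + B * cos psi) * cos (INR m * psi).
Proof.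
intros HB. rewrite cos_mult_cheb, Nat.add_1_r.
rewrite (sum_eq _ (fun p => cheb_pow m p * cos psi ^ p * (A / B)
   + match p with O => 0 | S q => cheb_pow m q end * cos psi ^ p))
  by (intros; rewrite acoef_cheb by assumption; ring).
rewrite sum_plus, <- scal_sum.
rewrite (decomp_sum (fun p => match p with O => 0 | S q => cheb_pow m q end
                              * cos psi ^ p)) by lia.
simpl Nat.pred.
rewrite (sum_eq (fun i => cheb_pow m i * cos psi ^ S i)
                (fun i => cheb_pow m i * cos psi ^ i * cos psi))
  by (intros; simpl pow; ring).
rewrite <- scal_sum. simpl sum_f_R0.
(* The sum runs to [m + 1], one past the degree of [T_m]. *)
rewrite (cheb_pow_0 m (S m)) by (intros; lia). field. assumption.
Qed.

(** * Elliptic integrals *)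

(* Goals coming from Coquelicot are equalities in [NormedModule.sort _], which
   [field] does not recognise as [R]. *)
Ltac real_eq := match goal with |- ?a = ?b => change (@eq R a b) end.

Lemma cos_pow2 (t : R) : cos t ^ 2 = 1 - sin t ^ 2.
Proof. assert (H := sin2_cos2 t). unfold Rsqr in H. simpl. lra. Qed.

(** The expression equals [cos^2 t + (1 - c) sin^2 t]. *)
Lemma one_minus_sin2_pos (c t : R) : c < 1 -> 0 < 1 - c * sin t ^ 2.
Proof.
intros Hc. assert (H := sin2_cos2 t). unfold Rsqr in H.
destruct (Req_dec (sin t) 0) as [Hs|Hs]; [rewrite Hs; lra|].
assert (H0 : 0 < sin t * sin t) by nra.
assert (0 <= cos t * cos t) by nra. simpl. nra.
Qed.

(* The exponent is shifted by one, so that [i = 0] is the integral "V_(-1)"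
   through which [ellE] enters. *)
Definition ell_integrand (n k : R) (i : nat) (t : R) : R :=
  (1 - n * sin t ^ 2) / ((1 - n * sin t ^ 2) ^ i * sqrt (1 - k ^ 2 * sin t ^ 2)).

Lemma continuous_ell_integrand (n k : R) (i : nat) (t : R) :
  n < 1 -> k ^ 2 < 1 -> continuous (ell_integrand n k i) t.
Proof.
intros Hn Hk. assert (H1 := one_minus_sin2_pos n t Hn).
assert (H2 := one_minus_sin2_pos (k ^ 2) t Hk).
apply (ex_derive_continuous (V := R_NormedModule)). unfold ell_integrand.
auto_derive. assert (H3 := sqrt_lt_R0 _ H2).
replace (1 + - (k * (k * 1) * (sin t * (sin t * 1))))
  with (1 - k ^ 2 * sin t ^ 2) by ring.
replace (1 + - (n * (sin t * (sin t * 1)))) with (1 - n * sin t ^ 2) by ring.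
split; [exact H2|]. split; [|exact I].
apply Rmult_integral_contrapositive_currified; [apply pow_nonzero|]; lra.
Qed.

(** With [cos^2] eliminated, the numerator is a cubic in [sin^2 t], so for [n <> 0] the derivative
    is a combination of four consecutive [ell_integrand]. *)
Lemma is_derive_ell (n k : R) (i : nat) (t : R) : n < 1 -> k ^ 2 < 1 ->
  is_derive (fun t => sin t * cos t * sqrt (1 - k ^ 2 * sin t ^ 2)
                      / (1 - n * sin t ^ 2) ^ S i) t
    (((1 - 2 * sin t ^ 2) * (1 - k ^ 2 * sin t ^ 2) * (1 - n * sin t ^ 2)
      - k ^ 2 * sin t ^ 2 * (1 - sin t ^ 2) * (1 - n * sin t ^ 2)
      + 2 * INR (S i) * n * sin t ^ 2 * (1 - sin t ^ 2) * (1 - k ^ 2 * sin t ^ 2))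
     / (sqrt (1 - k ^ 2 * sin t ^ 2) * (1 - n * sin t ^ 2) ^ S (S i))).
Proof.
intros Hn Hk. assert (H1 := one_minus_sin2_pos n t Hn).
assert (H2 := one_minus_sin2_pos (k ^ 2) t Hk).
assert (H3 := sqrt_lt_R0 _ H2). assert (HD := sqrt_sqrt _ (Rlt_le _ _ H2)).
auto_derive.
- replace (1 + - (k * (k * 1) * (sin t * (sin t * 1))))
    with (1 - k ^ 2 * sin t ^ 2) by ring.
  replace (1 + - (n * (sin t * (sin t * 1)))) with (1 - n * sin t ^ 2) by ring.
  split; [exact H2|]. split; [|exact I].
  apply (pow_nonzero _ (S i)). lra.
- change (Nat.pred (S i)) with i.
  replace (1 + - (k * (k * 1) * (sin t * (sin t * 1))))
    with (1 - k ^ 2 * sin t ^ 2) by ring.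
  replace (1 + - (n * (sin t * (sin t * 1)))) with (1 - n * sin t ^ 2) by ring.
  change (match i with O => 1 | S _ => INR i + 1 end) with (INR (S i)).
  set (w := 1 - n * sin t ^ 2) in *.
  set (D := sqrt (1 - k ^ 2 * sin t ^ 2)) in *.
  rewrite <- !tech_pow_Rmult. assert (Hp := pow_nonzero w i ltac:(lra)).
  field_simplify_eq; [|split; [assumption | split; lra]].
  replace (D ^ 2) with (1 - k ^ 2 * sin t ^ 2) by (rewrite <- HD; ring).
  rewrite cos_pow2.
  ring.
Qed.

(** * Recurrence and reduction of the integrals *)

Definition ell_integral (n k : R) (i : nat) : R :=
  RInt (ell_integrand n k i) 0 (PI / 2).

Lemma is_RInt_ell (n k : R) (i : nat) : n < 1 -> k ^ 2 < 1 ->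
  is_RInt (ell_integrand n k i) 0 (PI / 2) (ell_integral n k i).
Proof.
intros Hn Hk. apply (RInt_correct (V := R_CompleteNormedModule)).
apply (ex_RInt_continuous (V := R_CompleteNormedModule)).
intros t _. apply continuous_ell_integrand; assumption.
Qed.

(** For [i = j + 1] this is the recurrence of [V]. At [i = 0] the term in [J 1] drops out, and
    [J 3], that is [V_2], is expressed through [J 0] and [J 2]. *)
Lemma ell_recurrence (n k : R) (i : nat) : n < 1 -> k ^ 2 < 1 ->
  let J := ell_integral n k in
  2 * (INR i + 1) * (1 - n) * (k ^ 2 - n) * J (S (S (S i))) =
  (2 * INR i - 1) * k ^ 2 * J i
  + 2 * INR i * (n * k ^ 2 + n - 3 * k ^ 2) * J (S i)
  + (2 * INR i + 1) * (n ^ 2 - 2 * n * k ^ 2 - 2 * n + 3 * k ^ 2) * J (S (S i)).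
Proof.
intros Hn Hk J.
set (c0 := (2 * INR i - 1) * k ^ 2).
set (c1 := 2 * INR i * (n * k ^ 2 + n - 3 * k ^ 2)).
set (c2 := (2 * INR i + 1) * (n ^ 2 - 2 * n * k ^ 2 - 2 * n + 3 * k ^ 2)).
set (c3 := 2 * (INR i + 1) * (1 - n) * (k ^ 2 - n)).
(* The integral of [f] is computed twice: by linearity, and from the primitive [F]. *)
set (f := fun t => c0 * ell_integrand n k i t + c1 * ell_integrand n k (S i) t
  + c2 * ell_integrand n k (S (S i)) t - c3 * ell_integrand n k (S (S (S i))) t).
assert (HJ : forall j, is_RInt (ell_integrand n k j) 0 (PI / 2) (J j))
  by (intros j; apply is_RInt_ell; assumption).
assert (Hf : is_RInt f 0 (PI / 2) (c0 * J i + c1 * J (S i) + c2 * J (S (S i))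
                                   - c3 * J (S (S (S i))))).
{ apply (is_RInt_minus (V := R_NormedModule));
    [apply (is_RInt_plus (V := R_NormedModule));
     [apply (is_RInt_plus (V := R_NormedModule))|]|];
   apply (is_RInt_scal (V := R_NormedModule)); apply HJ. }
(* The factor [n^2] clears the denominators that arise from [sin^2 t = (1 - w) / n]. *)
set (F := fun t => - n ^ 2 * (sin t * cos t * sqrt (1 - k ^ 2 * sin t ^ 2)
                      / (1 - n * sin t ^ 2) ^ S i)).
assert (HF : is_RInt f 0 (PI / 2) (minus (F (PI / 2)) (F 0))).
{ apply (is_RInt_derive (V := R_CompleteNormedModule)).
  - intros t _.
    assert (Hd := is_derive_scal _ _ (- n ^ 2) _ (is_derive_ell n k i t Hn Hk)).
    unfold F. evar_last; [exact Hd|].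
    assert (H1 := one_minus_sin2_pos n t Hn).
    assert (H2 := one_minus_sin2_pos (k ^ 2) t Hk).
    assert (H3 := sqrt_lt_R0 _ H2).
    unfold f, ell_integrand, c0, c1, c2, c3. rewrite S_INR.
    set (D := sqrt (1 - k ^ 2 * sin t ^ 2)) in *.
    rewrite <- !(tech_pow_Rmult (1 - n * sin t ^ 2)).
    assert (Hp := pow_nonzero (1 - n * sin t ^ 2) i ltac:(lra)).
    set (wi := (1 - n * sin t ^ 2) ^ i) in *.
    real_eq.
    field. repeat split; try assumption; lra.
  - intros t _. unfold f.
    apply (continuous_minus (V := R_NormedModule));
     [apply (continuous_plus (V := R_NormedModule));
      [apply (continuous_plus (V := R_NormedModule))|]|];
     apply (continuous_scal_r (V := R_NormedModule)), continuous_ell_integrand; assumption. }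
(* The boundary terms vanish through [cos (PI / 2) = 0] and [sin 0 = 0]. *)
assert (HF0 : minus (F (PI / 2)) (F 0) = 0).
{ unfold F, minus, plus, opp; simpl. rewrite cos_PI2, sin_0. unfold Rdiv. ring. }
rewrite HF0 in HF.
assert (E := is_RInt_unique _ _ _ _ Hf). rewrite (is_RInt_unique _ _ _ _ HF) in E.
lra.
Qed.

(** Pointwise, [n (1 - k^2 sin^2 t) = (n - k^2) + k^2 w], divided by the square root. *)
Lemma ellE_reduction (n k : R) : n < 1 -> k ^ 2 < 1 ->
  n * ellE k = (n - k ^ 2) * ell_integral n k 1
               + k ^ 2 * ell_integral n k 0.
Proof.
intros Hn Hk.
assert (HJ : forall j, is_RInt (ell_integrand n k j) 0 (PI / 2)
                               (ell_integral n k j))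
  by (intros j; apply is_RInt_ell; assumption).
assert (H := is_RInt_plus (V := R_NormedModule) _ _ _ _ _ _
  (is_RInt_scal (V := R_NormedModule) _ _ _ (n - k ^ 2) _ (HJ 1%nat))
  (is_RInt_scal (V := R_NormedModule) _ _ _ (k ^ 2) _ (HJ 0%nat))).
apply (is_RInt_unique (V := R_CompleteNormedModule)) in H.
change (plus ?a ?b) with (a + b) in H.
change (scal ?a ?b) with (a * b) in H. rewrite <- H.
unfold ellE. rewrite <- (RInt_scal (V := R_CompleteNormedModule)).
- apply RInt_ext. intros t _. change (scal ?a ?b) with (a * b).
  change (plus ?a ?b) with (a + b).
  assert (H1 := one_minus_sin2_pos n t Hn).
  assert (H2 := one_minus_sin2_pos (k ^ 2) t Hk).
  assert (H3 := sqrt_lt_R0 _ H2). assert (HD := sqrt_sqrt _ (Rlt_le _ _ H2)).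
  unfold ell_integrand. set (D := sqrt (1 - k ^ 2 * sin t ^ 2)) in *.
  apply (Rmult_eq_reg_r D); [|lra].
  rewrite Rmult_assoc, HD. simpl pow. field. simpl in H1. lra.
- apply (ex_RInt_continuous (V := R_CompleteNormedModule)). intros t _.
  apply (ex_derive_continuous (V := R_NormedModule)). auto_derive.
  replace (1 + - (k * (k * 1) * (sin t * (sin t * 1))))
    with (1 - k ^ 2 * sin t ^ 2) by ring.
  apply one_minus_sin2_pos; assumption.
Qed.

Lemma V_eq_integral (alpha k : R) (j : nat) :
  alpha ^ 2 < 1 -> k ^ 2 < 1 -> k ^ 2 <> alpha ^ 2 ->
  V alpha k j = ell_integral (alpha ^ 2) k (S j).
Proof.
intros Hn Hk Hkn.
assert (Hpos : forall t,
  1 - alpha ^ 2 * sin t ^ 2 <> 0 /\ sqrt (1 - k ^ 2 * sin t ^ 2) <> 0).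
{ intros t. split; apply Rgt_not_eq; [|apply sqrt_lt_R0];
    apply one_minus_sin2_pos; assumption. }
assert (HK : ellK k = ell_integral (alpha ^ 2) k 1).
{ apply RInt_ext. intros t _. unfold ell_integrand. destruct (Hpos t).
  set (w := 1 - alpha ^ 2 * sin t ^ 2) in *.
  set (D := sqrt _) in *. real_eq. field. repeat split; assumption. }
assert (HPi : ellPi (alpha ^ 2) k = ell_integral (alpha ^ 2) k 2).
{ apply RInt_ext. intros t _. unfold ell_integrand. destruct (Hpos t).
  set (w := 1 - alpha ^ 2 * sin t ^ 2) in *.
  set (D := sqrt _) in *. real_eq. field. repeat split; assumption. }
assert (Hrec : forall i, ell_integral (alpha ^ 2) k (S (S (S i))) =
  ((2 * INR i - 1) * k ^ 2 * ell_integral (alpha ^ 2) k i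
   + 2 * INR i * (alpha ^ 2 * k ^ 2 + alpha ^ 2 - 3 * k ^ 2)
     * ell_integral (alpha ^ 2) k (S i)
   + (2 * INR i + 1) * (alpha ^ 4 - 2 * alpha ^ 2 * k ^ 2 - 2 * alpha ^ 2 + 3 * k ^ 2)
     * ell_integral (alpha ^ 2) k (S (S i)))
  / (2 * (INR i + 1) * (1 - alpha ^ 2) * (k ^ 2 - alpha ^ 2))).
{ intros i. replace (alpha ^ 4) with ((alpha ^ 2) ^ 2) by ring.
  rewrite <- (ell_recurrence (alpha ^ 2) k i Hn Hk).
  assert (H := pos_INR i). real_eq. field. repeat split; lra. }
(* The recurrence has order three, so three consecutive values are carried. *)
assert (HV : V alpha k j = ell_integral (alpha ^ 2) k (S j)
  /\ V alpha k (S j) = ell_integral (alpha ^ 2) k (S (S j))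
  /\ V alpha k (S (S j)) = ell_integral (alpha ^ 2) k (S (S (S j))));
  [|apply HV].
induction j as [|j [IH0 [IH1 IH2]]].
- split; [exact HK|]. split; [exact HPi|].
  (* Once [ellE] is replaced, the terms in [ell_integral] of index 1 cancel and the recurrence at
     [i = 0] remains. *)
  rewrite Hrec. change (V alpha k 2) with
    (1 / (2 * (alpha ^ 2 - 1) * (k ^ 2 - alpha ^ 2)) *
      ((k ^ 2 - alpha ^ 2) * ellK k
       + alpha ^ 2 * ellE k
       + (2 * alpha ^ 2 * k ^ 2 + 2 * alpha ^ 2 - alpha ^ 4 - 3 * k ^ 2)
         * ellPi (alpha ^ 2) k)).
  rewrite HK, HPi.
  rewrite (ellE_reduction (alpha ^ 2) k Hn Hk). simpl INR. real_eq. field. split; lra.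
- split; [exact IH1|]. split; [exact IH2|].
  rewrite Hrec, <- IH0, <- IH1, <- IH2, S_INR.
  change (V alpha k (S (S (S j)))) with
    (1 / (2 * (INR j + 2) * (1 - alpha ^ 2) * (k ^ 2 - alpha ^ 2)) *
      ((2 * INR j + 1) * k ^ 2 * V alpha k j
       + 2 * (INR j + 1) * (alpha ^ 2 * k ^ 2 + alpha ^ 2 - 3 * k ^ 2)
         * V alpha k (S j)
       + (2 * INR j + 3)
         * (alpha ^ 4 - 2 * alpha ^ 2 * k ^ 2 - 2 * alpha ^ 2 + 3 * k ^ 2)
         * V alpha k (S (S j)))).
  assert (H := pos_INR j). real_eq. field. repeat split; lra.
Qed.

(** * The substitution *)

(* With [c = sqrt (1 - alpha^2)] this is the solution [psi] of
   [tan (psi / 2) = c * tan t], written so that it is smooth across [PI / 2]. *)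
Definition psi_of (c t : R) : R :=
  2 * (t - atan ((1 - c) * sin t * cos t / (cos t ^ 2 + c * sin t ^ 2))).

Lemma psi_of_denom_pos (c t : R) : 0 < c -> 0 < cos t ^ 2 + c * sin t ^ 2.
Proof.
intros Hc. assert (H := one_minus_sin2_pos (1 - c) t ltac:(lra)).
assert (H' := sin2_cos2 t). unfold Rsqr in H'. simpl in *. lra.
Qed.

Lemma is_derive_psi_of (c t : R) : 0 < c ->
  is_derive (psi_of c) t (2 * c / (1 - (1 - c ^ 2) * sin t ^ 2)).
Proof.
intros Hc. assert (Hd := psi_of_denom_pos c t Hc).
assert (Hw := one_minus_sin2_pos (1 - c ^ 2) t ltac:(nra)).
assert (Hcs := cos_pow2 t).
unfold psi_of. auto_derive; [simpl in Hd; lra|].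
set (x := (1 - c) * sin t * cos t / (cos t ^ 2 + c * sin t ^ 2)).
(* With [d = cos^2 t + c sin^2 t], one has [d^2 + ((1 - c) sin t cos t)^2 = cos^2 t + c^2 sin^2 t =
   w]. *)
assert (Hx : 1 + x ^ 2 = (1 - (1 - c ^ 2) * sin t ^ 2) / (cos t ^ 2 + c * sin t ^ 2) ^ 2).
{ unfold x. field_simplify_eq; [|lra].
  replace (cos t ^ 4) with ((cos t ^ 2) ^ 2) by ring. rewrite Hcs. ring. }
assert (Hx2 : 0 < 1 + x ^ 2) by (assert (0 <= x ^ 2) by apply pow2_ge_0; lra).
replace (cos t * (cos t * 1) + c * (sin t * (sin t * 1)))
  with (cos t ^ 2 + c * sin t ^ 2) by ring.
change ((1 - c) * sin t * cos t * / (cos t ^ 2 + c * sin t ^ 2)) with x.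
replace (1 + x * (x * 1)) with (1 + x ^ 2) by ring.
rewrite Hx. field_simplify_eq; [|split; lra].
replace (cos t ^ 4) with ((cos t ^ 2) ^ 2) by ring. rewrite Hcs. ring.
Qed.

Lemma cos_psi_of (c t : R) : 0 < c ->
  cos (psi_of c t) = 2 * cos t ^ 2 / (1 - (1 - c ^ 2) * sin t ^ 2) - 1.
Proof.
intros Hc. assert (Hd := psi_of_denom_pos c t Hc).
assert (Hw := one_minus_sin2_pos (1 - c ^ 2) t ltac:(nra)).
assert (Hcs := cos_pow2 t).
unfold psi_of.
set (x := (1 - c) * sin t * cos t / (cos t ^ 2 + c * sin t ^ 2)).
assert (Hx : 1 + x² = (1 - (1 - c ^ 2) * sin t ^ 2) / (cos t ^ 2 + c * sin t ^ 2) ^ 2).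
{ unfold x, Rsqr. field_simplify_eq; [|lra].
  replace (cos t ^ 4) with ((cos t ^ 2) ^ 2) by ring. rewrite Hcs. ring. }
assert (Hx2 : 0 < 1 + x²) by (assert (0 <= x²) by apply Rle_0_sqr; lra).
rewrite cos_2a_cos, cos_minus, cos_atan, sin_atan.
assert (HS := sqrt_lt_R0 _ Hx2). assert (HS2 := sqrt_sqrt _ (Rlt_le _ _ Hx2)).
set (S := sqrt (1 + x²)) in *.
(* [cos t + x sin t = cos t / d], because [d + (1 - c) sin^2 t = 1] for the denominator [d] of
   [x]. *)
replace (cos t * (1 / S) + sin t * (x / S))
  with (cos t / (cos t ^ 2 + c * sin t ^ 2) / S).
- transitivity (2 * (cos t / (cos t ^ 2 + c * sin t ^ 2)) ^ 2 / (S * S) - 1);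
    [field; split; lra|].
  rewrite HS2, Hx. field. split; lra.
- unfold x. field_simplify_eq; [|split; lra].
  replace (cos t ^ 3) with (cos t * cos t ^ 2) by ring. rewrite Hcs. ring.
Qed.

(** * Expansion of the integrand *)

Lemma is_RInt_sum_f_R0 (f : nat -> R -> R) (I : nat -> R) (a b : R) (n : nat) :
  (forall i, is_RInt (f i) a b (I i)) ->
  is_RInt (fun t => sum_f_R0 (fun i => f i t) n) a b (sum_f_R0 I n).
Proof.
intros H. induction n as [|n IH]; [exact (H 0%nat)|].
apply (is_RInt_plus (V := R_NormedModule)); [exact IH | apply H].
Qed.

(** The power [w^-j] is written [w / w^(j+1)] to match [ell_integrand] at index [S j]. *)
Lemma binomial_quotient (A B w : R) (p : nat) : B <> 0 -> 1 - A <> 0 -> w <> 0 ->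
  ((1 - A) / B + (B - 1 + A) / B / w) ^ p =
  sum_f_R0 (fun j => (B - 1 + A) ^ j / (B ^ p * powerRZ (1 - A) (Z.of_nat j - Z.of_nat p))
                     * Binomial.C p j * (w / w ^ S j)) p.
Proof.
intros HB HA Hw. rewrite Rplus_comm, binomial. apply sum_eq. intros j Hj.
replace (Z.of_nat j - Z.of_nat p)%Z with (- Z.of_nat (p - j))%Z by lia.
rewrite powerRZ_neg', <- pow_powerRZ.
replace (B ^ p) with (B ^ j * B ^ (p - j)) by (rewrite <- pow_add; f_equal; lia).
unfold Rdiv. rewrite !Rpow_mult_distr, !pow_inv, <- tech_pow_Rmult.
field. repeat split; try apply pow_nonzero; assumption.
Qed.

(** For [y = A + B cos psi], the substitution gives [1 - y = (1 - A + B) c^2 / w] and [1 + y = (1 +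
    A + B) (1 - k^2 sin^2 t) / w]; the radicand is their product. *)
Lemma sqrt_psi_of (A B n k c t : R) :
  B < 1 - A -> B < 1 + A -> 0 < B -> 0 < c ->
  n = 2 * B / (1 - A + B) -> c ^ 2 = 1 - n ->
  k ^ 2 = 4 * B / ((1 + A + B) * (1 - A + B)) -> k ^ 2 < 1 ->
  sqrt (1 - (A + B * cos (psi_of c t)) ^ 2) =
  sqrt ((1 - A + B) * (1 + A + B)) * c * sqrt (1 - k ^ 2 * sin t ^ 2)
  / (1 - n * sin t ^ 2).
Proof.
intros H1 H2 HB Hc Hn Hcn Hk Hk1.
assert (Hw := one_minus_sin2_pos n t ltac:(nra)).
assert (HD := one_minus_sin2_pos (k ^ 2) t Hk1).
assert (HM : 0 < (1 - A + B) * (1 + A + B)) by (apply Rmult_lt_0_compat; lra).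
assert (HD' := sqrt_lt_R0 _ HD). assert (HM' := sqrt_lt_R0 _ HM).
assert (HDD := sqrt_sqrt _ (Rlt_le _ _ HD)). assert (HMM := sqrt_sqrt _ (Rlt_le _ _ HM)).
set (D := sqrt (1 - k ^ 2 * sin t ^ 2)) in *. set (M := sqrt (_ * _)) in *.
assert (Hy : 0 <= M * c * D / (1 - n * sin t ^ 2)).
{ apply Rlt_le, Rdiv_lt_0_compat; [|exact Hw].
  repeat apply Rmult_lt_0_compat; assumption. }
(* As the right side is nonnegative, it suffices to compare radicands. *)
rewrite <- (sqrt_square _ Hy). f_equal.
transitivity ((M * M) * c ^ 2 * (D * D) / (1 - n * sin t ^ 2) ^ 2); [|field; lra].
rewrite HDD, HMM, cos_psi_of by exact Hc.
replace (1 - (1 - c ^ 2) * sin t ^ 2) with (1 - n * sin t ^ 2) by (rewrite Hcn; ring).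
rewrite cos_pow2.
rewrite Hk, Hcn.
assert (Hw2 : 1 - A + B - 2 * B * sin t ^ 2 <> 0).
{ replace (_ - _) with ((1 - A + B) * (1 - n * sin t ^ 2)).
  - apply Rmult_integral_contrapositive_currified; lra.
  - rewrite Hn. field. lra. }
rewrite Hn. field. repeat split; try lra.
Qed.

(** * The Fourier coefficient as a double sum *)

Theorem theorem3p2 (m : nat) (theta theta' theta2 theta2' A B alpha k : R)
  (htheta : 0 <= theta <= PI) (htheta' : 0 <= theta' <= PI)
  (htheta2 : 0 <= theta2 <= PI) (htheta2' : 0 <= theta2' <= PI)
  (hA : A = cos theta * cos theta'
            + sin theta * sin theta' * cos theta2 * cos theta2')
  (hB : B = sin theta * sin theta' * sin theta2 * sin theta2')
  (hBpos : 0 < B) (hminus : (1 - A) / B > 1) (hplus : (1 + A) / B > 1)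
  (halpha_pos : 0 < alpha) (hk_pos : 0 < k)
  (halpha : alpha ^ 2 = 2 * B / (1 - A + B))
  (hk : k ^ 2 = 4 * B / ((1 + A + B) * (1 - A + B))) :
  G_half m theta theta' theta2 theta2' =
  2 * B * neumann m / (PI * sqrt ((1 - A + B) * (1 + A + B))) *
  sum_f_R0 (fun p =>
    sum_f_R0 (fun j =>
      acoef A B m p
      * ((B - 1 + A) ^ j
         / (B ^ p * powerRZ (1 - A) (Z.of_nat j - Z.of_nat p)))
      * Binomial.C p j * V alpha k j) p) (m + 1).
Proof.
assert (H1 : B < 1 - A).
{ replace (1 - A) with ((1 - A) / B * B) by (field; lra). nra. }
assert (H2 : B < 1 + A).
{ replace (1 + A) with ((1 + A) / B * B) by (field; lra). nra. }
assert (Hn : alpha ^ 2 < 1).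
{ rewrite halpha. apply Rlt_div_l; lra. }
assert (HM : 0 < (1 - A + B) * (1 + A + B)) by (apply Rmult_lt_0_compat; lra).
(* Equivalent to [(1 - A - B) (1 + A - B) > 0]. *)
assert (Hk : k ^ 2 < 1).
{ rewrite hk. apply Rlt_div_l; nra. }
assert (Hkn : k ^ 2 <> alpha ^ 2).
{ assert (k ^ 2 - alpha ^ 2 = 2 * B * (1 - A - B) / ((1 - A + B) * (1 + A + B)))
    by (rewrite hk, halpha; field; lra).
  assert (0 < 2 * B * (1 - A - B) / ((1 - A + B) * (1 + A + B)))
    by (apply Rdiv_lt_0_compat; nra).
  lra. }
rewrite (G_half_integral m _ _ _ _ A B hA hB).
set (f := fun psi => _).
(* Abstracting the sequence lets one double sum serve for the values [V] and, pointwise, for their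
   integrands. *)
set (dsum := fun W : nat -> R => sum_f_R0 (fun p => sum_f_R0 (fun j =>
  acoef A B m p
  * ((B - 1 + A) ^ j / (B ^ p * powerRZ (1 - A) (Z.of_nat j - Z.of_nat p)))
  * Binomial.C p j * W j) p) (m + 1)).
change (sum_f_R0 _ (m + 1)) with (dsum (V alpha k)).
set (c := sqrt (1 - alpha ^ 2)).
assert (Hc : 0 < c) by (apply sqrt_lt_R0; lra).
assert (Hcn : c ^ 2 = 1 - alpha ^ 2) by (apply pow2_sqrt; lra).
assert (E0 : psi_of c 0 = 0).
{ unfold psi_of. rewrite sin_0. unfold Rdiv.
  rewrite Rmult_0_r, !Rmult_0_l, atan_0. ring. }
assert (E1 : psi_of c (PI / 2) = PI).
{ unfold psi_of. rewrite cos_PI2. unfold Rdiv.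
  rewrite Rmult_0_r, Rmult_0_l, atan_0. field. }
assert (E : is_RInt (fun t => 2 * B / sqrt ((1 - A + B) * (1 + A + B)) *
    dsum (fun j => ell_integrand (alpha ^ 2) k (S j) t)) 0 (PI / 2)
   (2 * B / sqrt ((1 - A + B) * (1 + A + B)) * dsum (V alpha k))).
{ apply (is_RInt_scal (V := R_NormedModule)). unfold dsum.
  apply is_RInt_sum_f_R0. intros p. apply is_RInt_sum_f_R0. intros j.
  apply (is_RInt_scal (V := R_NormedModule)).
  rewrite V_eq_integral by assumption.
  apply is_RInt_ell; assumption. }
assert (HM' := sqrt_lt_R0 _ HM).
replace (RInt f 0 PI) with
  (2 * B / sqrt ((1 - A + B) * (1 + A + B)) * dsum (V alpha k)).
{ field. split; [lra | apply PI_neq0]. }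
replace (RInt f 0 PI) with (RInt f (psi_of c 0) (psi_of c (PI / 2)))
  by (rewrite E0, E1; reflexivity).
rewrite <- (RInt_comp (V := R_CompleteNormedModule) f (psi_of c)
  (fun t => 2 * c / (1 - (1 - c ^ 2) * sin t ^ 2))).
- apply (is_RInt_unique (V := R_CompleteNormedModule)) in E.
  rewrite <- E. apply RInt_ext. intros t _.
  change (scal ?a ?b) with (a * b). unfold f.
  rewrite <- acoef_sum by lra.
  rewrite (sqrt_psi_of A B (alpha ^ 2) k c t) by assumption.
  replace (1 - (1 - c ^ 2) * sin t ^ 2) with (1 - alpha ^ 2 * sin t ^ 2)
    by (rewrite Hcn; ring).
  assert (Hw := one_minus_sin2_pos (alpha ^ 2) t Hn).
  assert (HD := sqrt_lt_R0 _ (one_minus_sin2_pos (k ^ 2) t Hk)).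
  (* The factors [c] and [1 / w] of [psi'] cancel against those of the square root. *)
  transitivity (2 * B / sqrt ((1 - A + B) * (1 + A + B)) *
    (/ sqrt (1 - k ^ 2 * sin t ^ 2) *
     sum_f_R0 (fun p => acoef A B m p * cos (psi_of c t) ^ p) (m + 1))).
  2: { real_eq. field. repeat split; lra. }
  f_equal. unfold dsum. rewrite scal_sum. apply sum_eq. intros p _.
  replace (cos (psi_of c t))
    with ((1 - A) / B + (B - 1 + A) / B / (1 - alpha ^ 2 * sin t ^ 2)).
  + rewrite binomial_quotient by lra.
    rewrite (Rmult_comm (acoef A B m p)), Rmult_assoc, Rmult_comm, scal_sum.
    apply sum_eq. intros j _. unfold ell_integrand, Rdiv. rewrite !Rinv_mult. ring.
  + rewrite cos_psi_of by exact Hc.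
    replace (1 - (1 - c ^ 2) * sin t ^ 2) with (1 - alpha ^ 2 * sin t ^ 2)
      by (rewrite Hcn; ring).
    rewrite cos_pow2.
    (* The definition of [alpha^2] solved for [1 - A]. *)
    assert (Hn' : 1 - A = B * (2 - alpha ^ 2) / alpha ^ 2).
    { rewrite halpha. field. lra. }
    replace (B - 1 + A) with (B - B * (2 - alpha ^ 2) / alpha ^ 2) by lra.
    rewrite Hn'. field. simpl in Hw |- *. repeat split; lra.
- intros t _. apply (ex_derive_continuous (V := R_NormedModule)). unfold f.
  auto_derive. set (x := cos (psi_of c t)).
  assert (Hx := COS_bound (psi_of c t)). fold x in Hx.
  (* Since [|x| <= 1], the value [A + B x] lies strictly between -1 and 1. *)
  assert (Hs : 0 < (1 - (A + B * x)) * (1 + (A + B * x)))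
    by (apply Rmult_lt_0_compat; nra).
  replace (1 + - ((A + B * x) * ((A + B * x) * 1)))
    with ((1 - (A + B * x)) * (1 + (A + B * x))) by ring.
  split; [exact Hs|]. split; [|exact I].
  apply Rgt_not_eq, sqrt_lt_R0, Hs.
- intros t _. split; [apply is_derive_psi_of; exact Hc|].
  apply (ex_derive_continuous (V := R_NormedModule)). auto_derive.
  assert (Hw := one_minus_sin2_pos (1 - c ^ 2) t ltac:(lra)).
  simpl in Hw. lra.
Qed.
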